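(* Let $Q$ be a valued cluster quiver with $|Q_0|=n$ whose underlying graph $\bar Q$ is a tree. Let $f(x)=\det(xI_n-B(Q))$ be the exchange polynomial of $Q$ and $g(x)=\det(xI_n-C(Q))$ the adjacency polynomial of the underlying valued graph $\bar Q$. Then, for $\lambda\in\mathbb{R}$, $f(\lambda\,\mathrm{i})=0$ if and only if $g(\lambda)=0$, where $\mathrm{i}=\sqrt{-1}$. Moreover, for distinct real numbers $\lambda_0,\lambda_1,\dots,\lambda_p$ and positive integers $n_0,n_1,\dots,n_p$ with $n_0+n_1+\cdots+n_p=n$, the distinct eigenvalues of $B(Q)$ are $\lambda_0\mathrm{i},\lambda_1\mathrm{i},\dots,\lambda_p\mathrm{i}$ with respective multiplicities $n_0,n_1,\dots,n_p$ if and only if the distinct eigenvalues of $C(Q)$ are $\lambda_0,\lambda_1,\dots,\lambda_p$ with respective multiplicities $n_0,n_1,\dots,n_p$.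
   Context: A valued cluster quiver $(Q,v)$ (written $Q$) is a finite quiver (oriented graph with vertex set $Q_0=\{1,\dots,n\}$ and arrow set $Q_1$) without loops and with at most one arrow between any pair of vertices (so in particular no oriented 2-cycles), together with a map $v:Q_1\to\mathbb{Z}_{>0}^2$, $v(\alpha)=(v(\alpha)_1,v(\alpha)_2)$, for which there is a map $d:Q_0\to\mathbb{Z}_{>0}$ such that $d(i)v(\alpha)_1=d(j)v(\alpha)_2$ for each arrow $\alpha:i\to j$. For an arrow $\alpha:i\to j$ write $v_{ij}=v(\alpha)_1$, $v_{ji}=v(\alpha)_2$. The exchange matrix $B(Q)=(b_{ij})_{n\times n}$ is defined by $b_{ij}=v_{ij}$ if there is an arrow $i\to j$, $b_{ij}=-v_{ij}$ if there is an arrow $j\to i$, and $b_{ij}=0$ otherwise. The adjacency matrix of the underlying valued graph $\bar Q$ is $C(Q)=(|b_{ij}|)_{n\times n}$. Multiplicity means algebraic multiplicity. *)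

(* Defs.v *)
From HB Require Import structures.
From mathcomp Require Import all_boot all_order all_algebra.
From mathcomp Require Import reals.
From mathcomp Require Import complex.

Set Implicit Arguments.
Unset Strict Implicit.
Unset Printing Implicit Defensive.

Import Order.TTheory GRing.Theory Num.Theory.
Local Open Scope ring_scope.

(* Vertices {1, ..., n} are encoded as 'I_n, i.e. shifted to {0, ..., n-1}. *)
Record valued_cluster_quiver (n : nat) := ValuedClusterQuiver {
  arrow : finType;
  src : arrow -> 'I_n;
  tgt : arrow -> 'I_n;
  val1 : arrow -> nat;
  val2 : arrow -> nat;
  arrow_noloop : forall a, src a != tgt a;
  (* unordered endpoints: excludes parallel and opposite arrows alike *)
  arrow_atmost1 : forall a b,
    [set src a; tgt a] = [set src b; tgt b] -> a = b;
  val1_gt0 : forall a, (0 < val1 a)%N;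
  val2_gt0 : forall a, (0 < val2 a)%N;
  val_symmetrizable : exists d : 'I_n -> nat,
    (forall i, (0 < d i)%N) /\
    (forall a, (d (src a) * val1 a)%N = (d (tgt a) * val2 a)%N)
}.

Section Quiver.
Variables (n : nat) (Q : valued_cluster_quiver n).

(* An arrow a : j -> i has v_{ij} = v(a)_2, whence the entry - val2 a. *)
Definition exchange_mx : 'M[int]_n :=
  \matrix_(i, j)
    match [pick a : arrow Q | (src a == i) && (tgt a == j)] with
    | Some a => (val1 a)%:Z
    | None =>
        match [pick a : arrow Q | (src a == j) && (tgt a == i)] with
        | Some a => - (val2 a)%:Z
        | None => 0
        end
    end.

Definition adjacency_mx : 'M[int]_n := \matrix_(i, j) `|exchange_mx i j|.

Definition exchange_poly : {poly int} := char_poly exchange_mx.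

Definition adjacency_poly : {poly int} := char_poly adjacency_mx.

Definition underlying_edge : rel 'I_n := fun i j =>
  [exists a : arrow Q,
    ((src a == i) && (tgt a == j)) || ((src a == j) && (tgt a == i))].

End Quiver.

(* Adjacent vertices x, y give the ucycle [:: x; y], so only duplicate-free
   closed walks through at least three vertices count as cycles of the graph. *)
Definition is_tree (n : nat) (e : rel 'I_n) : Prop :=
  [/\ (0 < n)%N,
      forall i j, connect e i j
    & forall c : seq 'I_n, ucycle e c -> (size c <= 2)%N].

Definition eigenvalues_with_mult (F : fieldType) (n : nat) (A : 'M[F]_n)
    (I : Type) (mu : I -> F) (m : I -> nat) : Prop :=
  (forall z : F, eigenvalue A z <-> exists k, z = mu k) /\
  (forall k, mup (mu k) (char_poly A) = m k).

(* Main.v *)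
Require Import Defs.
From HB Require Import structures.
From mathcomp Require Import all_boot all_order all_algebra.
From mathcomp Require Import reals.
From mathcomp Require Import complex.

(** The matrices B = B(Q) and iC, where C = C(Q), are conjugate by a diagonal
    matrix over the complex numbers, so B has the eigenvalues of C rotated by i,
    with the same multiplicities.

    Look for D = diag(i ^ h(x)) with h an integer function on the vertices.
    Entrywise DB = (iC)D says i ^ h(x) b_xy = i |b_xy| i ^ h(y), and because
    1/i = -i this follows from h(x) - h(y) = sgn b_xy for all neighbours x, y.
    These conditions are consistent on each edge since b_xy and b_yx have
    opposite signs, and they have a common solution because the graph is a
    forest ([forest_potential]): delete an edge {a, b}, take a
    potential for what is left, and correct it on the component of a, which does
    not contain b any more.

    The relation DB = (iC)D gives f(ix) = i^n g(x) as polynomials in x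
    ([char_poly_comp_scale]).  Since x |-> ix is an invertible substitution, it
    carries roots to roots and preserves their multiplicities
    ([mup_comp_scale]). *)

Set Implicit Arguments.
Unset Strict Implicit.
Unset Printing Implicit Defensive.

Import Order.TTheory GRing.Theory Num.Theory.
Local Open Scope ring_scope.
Local Open Scope complex_scope.

(** * Potentials on forests *)

Definition del_edge (T : eqType) (e : rel T) (a b : T) : rel T :=
  fun x y =>
    e x y && ~~ ((x == a) && (y == b) || (x == b) && (y == a)).

Lemma del_edge_sym (T : eqType) (e : rel T) (a b : T) :
  symmetric e -> symmetric (del_edge e a b).
Proof.
move=> e_sym x y; rewrite /del_edge e_sym orbC.
by rewrite andbC [in RHS]andbC ![(y == _) && _]andbC.
Qed.

Lemma ucycle_sub (T : eqType) (e e' : rel T) :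
  subrel e e' -> forall c, ucycle e c -> ucycle e' c.
Proof.
by move=> ee' c /andP[ec uc]; apply/andP; split=> //; apply: sub_cycle ec.
Qed.

(** A path from a to b avoiding the edge would be closed by it into a cycle of
    length at least 3: every edge of a forest is a bridge. *)
Lemma forest_bridge (T : finType) (e : rel T) (a b : T) :
  symmetric e -> irreflexive e ->
  (forall c, ucycle e c -> (size c <= 2)%N) ->
  e a b -> ~~ connect (del_edge e a b) a b.
Proof.
move=> e_sym e_irr e_acyc eab; apply/negP => /connectP[p0 p0P bE].
case/shortenP: p0P bE => p pP p_uniq _ bE.
have sub_e : subrel (del_edge e a b) e by move=> x y /andP[].
have /e_acyc /= : ucycle e (a :: p).
  rewrite /ucycle p_uniq andbT /= rcons_path (sub_path sub_e pP) /=.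
  by rewrite -bE e_sym.
case: p pP bE {p_uniq} => [|x [|y p]] //= => [_ ab|/andP[xP _] bx].
  by move: eab; rewrite ab e_irr.
by move: xP; rewrite -bx /del_edge !eqxx andbF.
Qed.

(** Induction on the number of edges.  Only one of the two ends of the deleted
    edge lies in the component on which the potential is corrected, so the
    difference across that edge can be given any prescribed value, while the
    differences across all other edges do not change. *)
Lemma forest_potential (T : finType) (V : zmodType) (e : rel T)
    (w : T -> T -> V) :
  symmetric e -> irreflexive e ->
  (forall c, ucycle e c -> (size c <= 2)%N) ->
  (forall x y, w y x = - w x y) ->
  exists h : T -> V, forall x y, e x y -> h x - h y = w x y.
Proof.
move=> + + + w_anti; move Em: #|[set z | e z.1 z.2]| => m.
elim/ltn_ind: m e Em => m IHm e Em e_sym e_irr e_acyc.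
have [/existsP[[a b] /= eab]|no_edge] := boolP [exists z, e z.1 z.2];
  last first.
  exists (fun=> 0) => x y exy; case/existsP: no_edge.
  by exists (x, y).
set e' := del_edge e a b.
have sub_e : subrel e' e by move=> x y /andP[].
have e'_sym : symmetric e' by apply: del_edge_sym.
have [|||h hP] := IHm #|[set z | e' z.1 z.2]| _ e' erefl e'_sym.
- rewrite -Em; apply/proper_card/properP; split.
    by apply/subsetP => z; rewrite !inE => /sub_e.
  by exists (a, b); rewrite !inE //= /e' /del_edge !eqxx andbF.
- by move=> x; apply/negbTE/negP => /sub_e; rewrite e_irr.
- by move=> c /(ucycle_sub sub_e)/e_acyc.
have ab_bridge := forest_bridge e_sym e_irr e_acyc eab.
pose d := w a b - (h a - h b).
pose h' x := h x + (if connect e' a x then d else 0).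
have h'ab : h' a - h' b = w a b.
  by rewrite /h' connect0 (negbTE ab_bridge) addr0 addrAC /d addrC subrK.
exists h' => x y exy.
have [e'xy|] := boolP (e' x y).
  have -> : h' x - h' y = h x - h y.
    rewrite /h' -(same_connect_r (sym_connect_sym e'_sym) (connect1 e'xy)).
    by rewrite opprD addrACA subrr addr0.
  exact: hP.
rewrite /e' /del_edge exy negbK => /orP[] /andP[/eqP-> /eqP->] //.
by rewrite w_anti -h'ab opprB.
Qed.

(** * Characteristic polynomials under scaling *)

(** The hypothesis turns into D (axI - B) = a (xI - C) D; take determinants and
    cancel the nonzero constant det D. *)
Lemma char_poly_comp_scale (F : fieldType) (n : nat) (a : F)
    (B C D : 'M[F]_n) :
  D \in unitmx -> D *m B = a *: (C *m D) ->
  char_poly B \Po (a *: 'X) = a ^+ n *: char_poly C.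
Proof.
move=> Du DB; pose phi := map_mx (comp_poly (a *: 'X)).
have phiB : phi _ _ (char_poly_mx B) = (a *: 'X)%:M - map_mx polyC B.
  rewrite /phi; apply/matrixP => i j; rewrite !mxE rmorphB rmorphMn /=.
  by rewrite comp_polyX comp_polyC.
have comm : map_mx polyC D *m phi _ _ (char_poly_mx B) =
            a%:P *: char_poly_mx C *m map_mx polyC D.
  rewrite phiB mulmxBr -map_mxM DB map_mxZ map_mxM -scalemxAl mulmxBl scalerBr.
  congr (_ - _).
  by rewrite mul_scalar_mx scalerA mul_polyC mul_mx_scalar.
move/(congr1 determinant): comm.
have D0 : (\det D)%:P != 0 by rewrite polyC_eq0 -unitfE -unitmxE.
rewrite !det_mulmx detZ /phi !det_map_mx -rmorphXn mulrC.
by move/(mulIf D0) => ->; rewrite mul_polyC.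
Qed.

Lemma comp_scaleK (F : fieldType) (a : F) (p : {poly F}) :
  a != 0 -> (p \Po (a *: 'X)) \Po (a^-1 *: 'X) = p.
Proof.
move=> a0; rewrite -comp_polyA comp_polyZ comp_polyX scalerA divff //.
by rewrite scale1r comp_polyXr.
Qed.

Lemma comp_scale_eq0 (F : fieldType) (a : F) (p : {poly F}) :
  a != 0 -> (p \Po (a *: 'X) == 0) = (p == 0).
Proof.
move=> a0; apply/eqP/eqP => [p0|->]; last by rewrite comp_poly0.
by rewrite -(comp_scaleK p a0) p0 comp_poly0.
Qed.

(** Substituting ax turns the divisor (x - az)^k into a unit multiple of
    (x - z)^k; the converse inequality is the substitution by x/a. *)
Lemma mup_comp_scale (F : fieldType) (a z : F) (p : {poly F}) :
  a != 0 -> p != 0 -> mup z (p \Po (a *: 'X)) = mup (a * z) p.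
Proof.
move=> a0 p0.
have le_mup (b y : F) (q : {poly F}) : b != 0 -> q != 0 ->
    (mup (b * y) q <= mup y (q \Po (b *: 'X)))%N.
  move=> b0 q0; rewrite mup_geq ?comp_scale_eq0 //.
  have : ('X - (b * y)%:P) ^+ mup (b * y) q %| q by rewrite -mup_geq.
  move/(dvdp_comp_poly (b *: 'X)).
  rewrite rmorphXn rmorphB /= comp_polyX comp_polyC.
  have -> : b *: 'X - (b * y)%:P = b *: ('X - y%:P).
    by rewrite scalerBr -mul_polyC polyCM -[_ *: y%:P]mul_polyC.
  by rewrite exprZn dvdpZl // expf_neq0.
apply/eqP; rewrite eqn_leq le_mup // andbT.
have := le_mup a^-1 (a * z) (p \Po (a *: 'X)).
by rewrite invr_eq0 comp_scale_eq0 // comp_scaleK // mulKf //; apply.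
Qed.

Lemma mupZ (F : fieldType) (c z : F) (p : {poly F}) :
  c != 0 -> mup z (c *: p) = mup z p.
Proof. by move=> c0; rewrite -mul_polyC mupMr // rootC. Qed.

Lemma root_char_poly_scale (F : fieldType) (n : nat) (a : F) (B C : 'M[F]_n) :
  a != 0 -> char_poly B \Po (a *: 'X) = a ^+ n *: char_poly C -> forall z,
  root (char_poly B) (z * a) = root (char_poly C) z.
Proof.
move=> a0 BC z; rewrite mulrC.
have := root_comp (char_poly B) (a *: 'X) z.
by rewrite BC hornerZ hornerX rootZ ?expf_neq0.
Qed.

Lemma mup_char_poly_scale (F : fieldType) (n : nat) (a : F) (B C : 'M[F]_n) :
  a != 0 -> char_poly B \Po (a *: 'X) = a ^+ n *: char_poly C -> forall z,
  mup (z * a) (char_poly B) = mup z (char_poly C).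
Proof.
move=> a0 BC z; rewrite mulrC.
have char_poly0 A : char_poly (A : 'M[F]_n) != 0.
  exact/monic_neq0/char_poly_monic.
by rewrite -mup_comp_scale // BC mupZ ?expf_neq0.
Qed.

Lemma eigenvalues_with_mult_scale (F : fieldType) (n : nat) (a : F)
    (B C : 'M[F]_n) (I : Type) (mu : I -> F) (m : I -> nat) :
  a != 0 -> char_poly B \Po (a *: 'X) = a ^+ n *: char_poly C ->
  eigenvalues_with_mult B (fun k => mu k * a) m <->
  eigenvalues_with_mult C mu m.
Proof.
move=> a0 BC; have eigE z : eigenvalue B (z * a) = eigenvalue C z.
  by rewrite !eigenvalue_root_char (root_char_poly_scale a0 BC).
split=> -[eig mult]; split.
- move=> z; rewrite -eigE; apply: iff_trans (eig _) _.
  by split=> -[k zk]; exists k; [apply: (mulIf a0)|rewrite zk].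
- by move=> k; rewrite -mult (mup_char_poly_scale a0 BC).
- move=> z; rewrite -[z](mulfVK a0) eigE; apply: iff_trans (eig _) _.
  by split=> -[k zk]; exists k; [rewrite zk|apply: (mulIf a0)].
- by move=> k; rewrite -mult (mup_char_poly_scale a0 BC).
Qed.

(** * The exchange matrix of a tree quiver *)

Lemma complexi_neq0 (R : rcfType) : 'i%C != 0 :> R[i].
Proof. by rewrite -sqrf_eq0 sqr_i oppr_eq0 oner_eq0. Qed.

Section Quiver.
Variables (n : nat) (Q : valued_cluster_quiver n).
Local Notation B := (exchange_mx Q).

Lemma no_opposite_arrows (a b : arrow Q) :
  src a = tgt b -> tgt a = src b -> False.
Proof.
move=> ab ba; have /arrow_atmost1 eab : [set src a; tgt a] = [set src b; tgt b].
  by rewrite ab ba setUC.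
by move: (arrow_noloop a); rewrite ab eab eqxx.
Qed.

Lemma sgz_exchange_anti i j : sgz (B j i) = - sgz (B i j).
Proof.
have sgz_val1 (a : arrow Q) : sgz (Defs.val1 a)%:Z = 1.
  by rewrite gtr0_sgz // ltz_nat val1_gt0.
have sgz_val2 (a : arrow Q) : sgz (- (Defs.val2 a)%:Z) = -1.
  by rewrite sgzN gtr0_sgz // ltz_nat val2_gt0.
rewrite !mxE.
case: pickP => [a /andP[/eqP sa /eqP ta]|_].
  case: pickP => [b /andP[/eqP sb /eqP tb]|_].
    by case: (@no_opposite_arrows a b); congruence.
  by rewrite sgz_val1 sgz_val2 opprK.
by case: pickP => [a _|_]; rewrite ?sgz_val1 ?sgz_val2 ?sgz0 ?oppr0.
Qed.

Lemma exchange_neq0_edge i j : B i j != 0 -> underlying_edge Q i j.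
Proof.
rewrite mxE; case: pickP => [a aP _|_].
  by apply/existsP; exists a; rewrite aP.
by case: pickP => // a aP _; apply/existsP; exists a; rewrite aP orbT.
Qed.

Lemma underlying_edge_sym : symmetric (underlying_edge Q).
Proof. by move=> i j; apply: eq_existsb => a; rewrite orbC. Qed.

Lemma underlying_edge_irr : irreflexive (underlying_edge Q).
Proof.
move=> i; apply/existsP => -[a]; rewrite orbb => /andP[/eqP si /eqP ti].
by move: (arrow_noloop a); rewrite si ti eqxx.
Qed.

(** The conjugating matrix is diag(i ^ h), for a potential h whose difference
    along an arrow from x to y is 1 = sgn b_xy. *)
Lemma char_poly_exchange (R : rcfType) : is_tree (underlying_edge Q) ->
  char_poly (map_mx intr B : 'M[R[i]]_n) \Po ('i%C *: 'X) =
  'i%C ^+ n *: char_poly (map_mx intr (adjacency_mx Q)).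
Proof.
case=> _ _ acyc.
have [h hP] := forest_potential underlying_edge_sym underlying_edge_irr acyc
  (fun i j => sgz_exchange_anti i j).
have i0 := complexi_neq0 R.
have iV : 'i%C ^ (-1) = - 'i%C :> R[i].
  by apply: (mulfI i0); rewrite exprN1 divff // mulrN -expr2 sqr_i opprK.
have edge := exchange_neq0_edge.
rewrite /adjacency_mx; move: B hP edge => E hP edge.
apply: (@char_poly_comp_scale _ _ _ _ _ (diag_mx (\row_k 'i%C ^ h k))).
  rewrite unitmxE det_diag unitfE; apply/prodf_neq0 => k _.
  by rewrite mxE expfz_neq0.
apply/matrixP => k l; rewrite mul_diag_mx mul_mx_diag !mxE.
have [->|b0] := eqVneq (E k l) 0; first by rewrite normr0 mulr0 mul0r mulr0.
have -> : h k = sgz (E k l) + h l.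
  by rewrite -(hP _ _ (edge _ _ b0)) subrK.
rewrite expfzDr // mulrAC mulrA; congr (_ * _).
(* For b > 0 both sides are ib; for b < 0 they agree because 1/i = -i. *)
case: sgzP b0 => // _ _.
by rewrite iV rmorphN mulrN mulNr.
Qed.

End Quiver.

Theorem proposition3p5 (R : realType) (n : nat) (Q : valued_cluster_quiver n)
    (Qtree : is_tree (underlying_edge Q)) :
  (forall lambda : R,
     (map_poly intr (exchange_poly Q)).[lambda%:C * 'i%C : R[i]] = 0 <->
     (map_poly intr (adjacency_poly Q)).[lambda] = 0) /\
  (forall (p : nat) (lambda : 'I_p.+1 -> R) (m : 'I_p.+1 -> nat),
     injective lambda ->
     (forall k, (0 < m k)%N) ->
     (\sum_(k < p.+1) m k)%N = n ->
     (eigenvalues_with_mult (map_mx intr (exchange_mx Q) : 'M[R[i]]_n)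
        (fun k => (lambda k)%:C * 'i%C) m <->
      eigenvalues_with_mult (map_mx intr (adjacency_mx Q) : 'M[R[i]]_n)
        (fun k => (lambda k)%:C) m)).
Proof.
have i0 := complexi_neq0 R.
have scale := char_poly_exchange R Qtree.
split=> [lambda|p lambda m _ _ _].
  (* The root of g is sought in R, but f and g are compared over R[i]. *)
  have adjC : map_poly intr (adjacency_poly Q) =
      map_poly (real_complex R) (map_poly intr (adjacency_poly Q)).
    by rewrite -map_poly_comp; apply: eq_map_poly => z /=; rewrite rmorph_int.
  have := root_char_poly_scale i0 scale lambda%:C.
  rewrite -!map_char_poly -/(exchange_poly Q) -/(adjacency_poly Q) adjC.
  rewrite fmorph_root => rootE.
  by split=> /rootP; [rewrite rootE|rewrite -rootE] => /rootP.
exact: eigenvalues_with_mult_scale.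
Qed.
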